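(* For $n\ge2$, $$\sum_{\sigma\in\mathcal D^D_n}(-1)^{\ell_D(\sigma)}q^{\mathrm{Dmaj}(\sigma)}=[2]_q\cdots[2n-2]_q\sum_{k=0}^{n-2}\frac{(-1)^{n-1}q^{2\binom k2}}{[2]_q\cdots[2k]_q}\left(\frac{1-q}{1+q}\right)^{\lfloor (n-k)/2\rfloor}\frac{2q^{2k+1}\big(1+(-1)^{n-k}q^{n-k-1}\big)-\big(1+(-1)^{n-k}\big)q}{2(1-q)}.$$
   Context: $B_n$ is the set of words $\sigma=\sigma_1\cdots\sigma_n$ with $\sigma_i\in\{\pm1,\dots,\pm n\}$ and $|\sigma_1|\cdots|\sigma_n|$ a permutation of $[n]$; $\mathrm{neg}(\sigma)$ is the number of negative letters; $D_n=\{\sigma\in B_n:\mathrm{neg}(\sigma)\text{ even}\}$; $\mathcal D^D_n$ is the set of $\sigma\in D_n$ with $\sigma_i\ne i$ for all $i$. $\mathrm{inv}(\sigma)=\#\{(i,j):i<j,\sigma_i>\sigma_j\}$ (usual order), $\ell_B(\sigma)=\mathrm{inv}(\sigma)-\sum_{i:\sigma_i<0}\sigma_i$, $\ell_D(\sigma)=\ell_B(\sigma)-\mathrm{neg}(\sigma)$. Order $\prec$: $-1\prec-2\prec\cdots\prec-N\prec1\prec\cdots\prec N$; $\mathrm{maj}_\prec(w)=\sum_{i:w_i\succ w_{i+1}}i$; $\mathrm{fmaj}(w)=2\mathrm{maj}_\prec(w)+\mathrm{neg}(w)$; $\mathrm{Dmaj}(\sigma)=\mathrm{fmaj}(\sigma_1\cdots\sigma_{n-1}|\sigma_n|)$.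 $[m]_q=1+q+\dots+q^{m-1}$; empty products equal $1$. *)

(* Defs.v *)
From HB Require Import structures.
From mathcomp Require Import all_boot all_order.
From mathcomp Require Import fingroup perm.
From mathcomp Require Import all_algebra fraction.
Set Implicit Arguments. Unset Strict Implicit. Unset Printing Implicit Defensive.
Import Order.TTheory GRing.Theory Num.Theory.

(* A signed permutation sigma in B_n is encoded as a pair (p, s) with
   p : 'S_n and s : {ffun 'I_n -> bool}; the (0-indexed) letter i is
   sigma_{i+1} = (-1)^(s i) * (p i + 1). This is a bijection onto B_n. *)
Definition sword (n : nat) : finType := ('S_n * {ffun 'I_n -> bool})%type.

Section Stats.
Local Open Scope ring_scope.
Variable n : nat.
Implicit Type s : sword n.

Definition sletter s (i : 'I_n) : int :=
  if s.2 i then - ((s.1 i).+1)%N%:Z else ((s.1 i).+1)%N%:Z.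

Definition sletter_nat s (k : nat) : int :=
  if insub k is Some i then sletter s i else 0.

Definition negs s : nat := #|[set i : 'I_n | s.2 i]|.

Definition inD s : bool := ~~ odd (negs s).

Definition inDD s : bool :=
  inD s && [forall i : 'I_n, sletter s i != (i.+1)%N%:Z].

Definition inv s : nat :=
  #|[set ij : 'I_n * 'I_n | ((ij.1 < ij.2)%N && (sletter s ij.2 < sletter s ij.1))]|.

Definition ellB s : int := (inv s)%:Z - \sum_(i : 'I_n | s.2 i) sletter s i.
Definition ellD s : int := ellB s - (negs s)%:Z.

(* x \succ y for the order -1 < -2 < ... < -N < 1 < ... < N *)
Definition prec_gt (x y : int) : bool :=
  [|| (0 < x) && (y < 0),
      [&& 0 < x, 0 < y & y < x] |
      [&& x < 0, y < 0 & x < y]].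

Definition dword s (k : nat) : int :=
  if k == n.-1 then `|sletter_nat s k| else sletter_nat s k.

(* maj_prec of that word : sum of positions k+1 (1-indexed) with w_{k+1} > w_{k+2} *)
Definition dmaj_prec s : nat :=
  \sum_(0 <= k < n.-1 | prec_gt (dword s k) (dword s k.+1)) k.+1.

Definition dneg s : nat := \sum_(0 <= k < n | dword s k < 0) 1.

Definition Dmaj s : nat := 2 * dmaj_prec s + dneg s.

End Stats.

Definition qX : {fraction {poly rat}} := @FracField.tofrac {poly rat} 'X.

Definition qint (R : ringType) (q : R) (m : nat) : R := (\sum_(i < m) q ^+ i)%R.

(* Main.v *)
Require Import Defs.
From HB Require Import structures.
From mathcomp Require Import all_boot all_order.
From mathcomp Require Import fingroup perm.
From mathcomp Require Import all_algebra fraction.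
From mathcomp Require Import ring zify.
Import Order.TTheory GRing.Theory Num.Theory.
Local Open Scope ring_scope.
Set Implicit Arguments. Unset Strict Implicit. Unset Printing Implicit Defensive.

(** On D_n one has (-1)^{l_D} = sgn |sigma|, and making the last letter positive
    identifies D_n with the signed permutations whose last letter is positive,
    so the sum is one over signed permutations weighted by sgn |s| q^{fmaj s}.
    Up to the fixed point at n this splits as (derangements with positive last
    letter) + (derangements of B_{n-1} with neg odd).

    Without the derangement condition the sums have closed forms: the sum over
    words of length n+1 with last letter +-(r+1) is proportional to
    ((-1)^n q)^{n-r}, by induction on n, deleting the last letter.

    The derangement condition is handled as in Wachs's theorem.  A signed
    permutation is a derangement of the set U of its non-fixed points.  With the
    standardized derangement kept fixed, the sum of q^{2 maj} over all m-subsets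
    U of [n] is a q^2-binomial coefficient times q^{2 maj} of the derangement,
    and the sign is unchanged.  Inverting these q-binomial relations and
    inserting the closed forms gives the formula term by term. *)

(** * Gaussian binomial coefficients *)

Section QBinomial.
Variable R : comNzRingType.
Variable Q : R.

Fixpoint qbin (n k : nat) : R :=
  match n, k with
  | _, 0%N => 1
  | 0%N, _.+1 => 0
  | n'.+1, k'.+1 => qbin n' k' + Q ^+ k'.+1 * qbin n' k'.+1
  end.

Lemma qbin0 n : qbin n 0 = 1. Proof. by case: n. Qed.

Lemma qbinS n k : qbin n.+1 k.+1 = qbin n k + Q ^+ k.+1 * qbin n k.+1.
Proof. by []. Qed.

Lemma qbin_small n k : (n < k)%N -> qbin n k = 0.
Proof.
elim: n k => [|n IH] [|k] //= lt_nk.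
by rewrite !IH ?mulr0 ?addr0 // ltnW.
Qed.

Lemma qbinn n : qbin n n = 1.
Proof. by elim: n => //= n ->; rewrite qbin_small // mulr0 addr0. Qed.

Lemma qbinS_dual n k : (k <= n)%N ->
  qbin n.+1 k.+1 = Q ^+ (n - k) * qbin n k + qbin n k.+1.
Proof.
elim: n k => [|n IH] k le_kn.
  by move: le_kn; rewrite leqn0 => /eqP -> /=; ring.
case: (ltnP n k) => [lt_nk|le_kn1].
  have -> : k = n.+1 by lia.
  by rewrite subnn !qbinn !(@qbin_small n.+1 n.+2) // expr0 mulr1 addr0.
rewrite [LHS]qbinS [in LHS](IH k le_kn1) [in X in _ = _ + X]qbinS.
case: k le_kn le_kn1 => [|k] le_kn le_kn1.
  by rewrite !qbin0 !subn0 !exprS; ring.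
rewrite [in LHS](IH k (ltnW le_kn1)) [in RHS]qbinS subSS.
have -> : (n - k = (n - k.+1).+1)%N by lia.
rewrite !exprS; ring.
Qed.

Definition qpoch n : R := \prod_(1 <= j < n.+1) (1 - Q ^+ j).

Lemma qpochS n : qpoch n.+1 = qpoch n * (1 - Q ^+ n.+1).
Proof. by rewrite /qpoch big_nat_recr. Qed.

(** The q-factorial formula without division. The instances [(a, b.+1)] and [(a.+1, b)] are combined
    with weights [1 - Q ^+ a.+1] and [Q ^+ a.+1 * (1 - Q ^+ b.+1)], which add up to
    [1 - Q ^+ (a + b).+2]. *)
Lemma qbin_fact a b : qbin (a + b) a * qpoch a * qpoch b = qpoch (a + b).
Proof.
elim: a b => [|a IHa] b.
  by rewrite qbin0 /qpoch big_geq // !mul1r.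
elim: b => [|b IHb].
  by rewrite addn0 qbinn mul1r [qpoch 0]big_geq // mulr1.
rewrite addSn qbinS.
have := IHa b.+1; rewrite !qpochS addnS => IHa'.
have := IHb; rewrite qpochS addSn => IHb'.
rewrite mulrDl mulrDl.
transitivity ((1 - Q ^+ a.+1) * (qbin (a + b).+1 a * qpoch a * (qpoch b * (1 - Q ^+ b.+1)))
   + Q ^+ a.+1 * (1 - Q ^+ b.+1) * (qbin (a + b).+1 a.+1 * (qpoch a * (1 - Q ^+ a.+1)) * qpoch b)).
  ring.
rewrite IHa' IHb' !qpochS.
have -> : Q ^+ (a + b).+2 = Q ^+ a.+1 * Q ^+ b.+1 by rewrite -exprD addSn addnS.
ring.
Qed.

(** A telescoping form of every partial sum; the full sum vanishes because [qbin n n.+1] does. *)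
Lemma qbin_alternating_partial n j :
  \sum_(k < j.+1) (-1) ^+ k * Q ^+ 'C(k, 2) * qbin n.+1 k
  = (-1) ^+ j * Q ^+ 'C(j.+1, 2) * qbin n j.
Proof.
elim: j => [|j IHj]; first by rewrite big_ord_recl big_ord0 /= !qbin0 addr0.
rewrite big_ord_recr IHj /= (binS j.+1 1) bin1 exprD !exprS; ring.
Qed.

Lemma qbin_alternating n :
  \sum_(k < n.+1) (-1) ^+ k * Q ^+ 'C(k, 2) * qbin n k = (n == 0%N)%:R.
Proof.
case: n => [|n]; first by rewrite big_ord_recl big_ord0 /= !mulr1 addr0.
by rewrite qbin_alternating_partial qbin_small // mulr0.
Qed.

End QBinomial.

Arguments qbin : simpl never.

Lemma sum_triangle (V : nmodType) (f : nat -> nat -> V) N :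
  \sum_(k < N.+1) \sum_(i < (N - k).+1) f k i
  = \sum_(s < N.+1) \sum_(k < s.+1) f k (s - k)%N.
Proof.
elim: N => [|N IH]; first by rewrite !big_ord1.
rewrite [RHS]big_ord_recr -IH /= [X in _ + X]big_ord_recr /=.
rewrite big_ord_recr /= subnn big_ord1 addrA; congr (_ + _).
rewrite -big_split /=; apply: eq_bigr => k _.
by rewrite subSn ?leq_ord // big_ord_recr.
Qed.

(** * Inversion of q-binomial relations *)

Section Inversion.
Variables (F : fieldType) (Q : F).
Hypothesis Qn1 : forall j, (0 < j)%N -> Q ^+ j != 1.

Lemma qpoch_neq0 n : qpoch Q n != 0.
Proof.
elim: n => [|n IH]; first by rewrite /qpoch big_geq ?oner_neq0.
by rewrite qpochS mulf_neq0 // subr_eq0 eq_sym Qn1.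
Qed.

Lemma qbin_fracE n k : (k <= n)%N ->
  qbin Q n k = qpoch Q n / (qpoch Q k * qpoch Q (n - k)).
Proof.
move=> le_kn; have := qbin_fact Q k (n - k); rewrite subnKC // => <-.
by rewrite -[X in X / _]mulrA mulfK // mulf_neq0 ?qpoch_neq0.
Qed.

(** Substituting the hypothesis and collecting the terms with [k + i = s] leaves the alternating sum
    of [qbin Q s k], zero unless [s = 0]. The twist [z] is later taken to be [1] and [Q]. *)
Lemma qbin_inversion (z : F) (a b : nat -> F) :
  (forall n, a n = \sum_(i < n.+1) z ^+ i * qbin Q n i * b (n - i)%N) ->
  forall n, b n =
    \sum_(k < n.+1) (-1) ^+ k * Q ^+ 'C(k, 2) * z ^+ k * qbin Q n k * a (n - k)%N.
Proof.
move=> ab n.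
pose f k i := (-1) ^+ k * Q ^+ 'C(k, 2) * z ^+ k * qbin Q n k *
  (z ^+ i * qbin Q (n - k) i * b (n - k - i)%N).
transitivity (\sum_(k < n.+1) \sum_(i < (n - k).+1) f k i); last first.
  by apply: eq_bigr => k _; rewrite ab mulr_sumr.
rewrite sum_triangle big_ord_recl big_ord_recl big_ord0 /f /= !qbin0 big1.
  by rewrite ?subn0 ?bin0n ?subnn !expr0 ?mul1r ?mulr1 ?addr0.
move=> s _; rewrite /bump add1n /=.
transitivity (z ^+ s.+1 * qbin Q n s.+1 * b (n - s.+1)%N *
   \sum_(k < s.+2) (-1) ^+ k * Q ^+ 'C(k, 2) * qbin Q s.+1 k); last first.
  by rewrite qbin_alternating mulr0.
rewrite mulr_sumr; apply: eq_bigr => k _.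
have lt_sn := ltn_ord s; have lt_ks := leq_ord k.
have -> : (n - k - (s.+1 - k) = n - s.+1)%N by lia.
have -> : z ^+ s.+1 = z ^+ k * z ^+ (s.+1 - k) by rewrite -exprD subnKC.
(* The q-analogue of choosing a subset inside a subset. *)
have E : qbin Q n k * qbin Q (n - k) (s.+1 - k) = qbin Q n s.+1 * qbin Q s.+1 k.
  rewrite !qbin_fracE; try lia.
  have -> : (n - k - (s.+1 - k) = n - s.+1)%N by lia.
  by field; rewrite !qpoch_neq0.
transitivity ((-1) ^+ k * Q ^+ 'C(k, 2) * (z ^+ k * z ^+ (s.+1 - k)) * b (n - s.+1)%N *
  (qbin Q n k * qbin Q (n - k) (s.+1 - k))); first by ring.
by rewrite E; ring.
Qed.

End Inversion.

(** * Placing a derangement among fixed points *)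

Section Masks.

(* Total accessors ([fget], [absv] below) are indexed by nat, with junk value outside 'I_n. *)
Definition fget n (f : {ffun 'I_n -> bool}) (k : nat) : bool :=
  if insub k is Some i then f i else false.

Definition frcons n (g : {ffun 'I_n -> bool}) (e : bool) : {ffun 'I_n.+1 -> bool} :=
  [ffun i => if unlift ord_max i is Some j then g j else e].

Lemma fget_ord n (f : {ffun 'I_n -> bool}) (i : 'I_n) : fget f i = f i.
Proof. by rewrite /fget valK. Qed.

Lemma fget_out n (f : {ffun 'I_n -> bool}) k : (n <= k)%N -> fget f k = false.
Proof. by move=> le_nk; rewrite /fget insubN // -leqNgt. Qed.

Lemma lift_max_val n (j : 'I_n) : lift ord_max j = j :> nat.
Proof. by rewrite /= /bump leqNgt ltn_ord. Qed.

Lemma frcons_max n (g : {ffun 'I_n -> bool}) e : frcons g e ord_max = e.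
Proof. by rewrite ffunE unlift_none. Qed.

Lemma frcons_lift n (g : {ffun 'I_n -> bool}) e j :
  frcons g e (lift ord_max j) = g j.
Proof. by rewrite ffunE liftK. Qed.

Lemma fget_frcons n (g : {ffun 'I_n -> bool}) e k :
  fget (frcons g e) k = if (k < n)%N then fget g k else (k == n) && e.
Proof.
case: ltngtP => [lt_kn|lt_nk|->].
- have -> : k = lift ord_max (Ordinal lt_kn) :> nat by rewrite lift_max_val.
  by rewrite fget_ord frcons_lift lift_max_val fget_ord.
- by rewrite fget_out.
- by rewrite -[X in fget _ X]/(nat_of_ord (@ord_max n)) fget_ord frcons_max.
Qed.

Lemma frcons_bij n : bijective (fun u : bool * {ffun 'I_n -> bool} => frcons u.2 u.1).
Proof.
apply: inj_card_bij => [[e g] [e' g'] /= eq_f|].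
  congr (_, _); first by rewrite -(frcons_max g e) eq_f frcons_max.
  by apply/ffunP=> j; rewrite -(frcons_lift g e) eq_f frcons_lift.
by rewrite card_prod !card_ffun !card_ord card_bool expnS.
Qed.

Lemma sum_frcons (V : nmodType) n (P : pred {ffun 'I_n.+1 -> bool})
    (G : {ffun 'I_n.+1 -> bool} -> V) :
  \sum_(f | P f) G f
  = \sum_(e : bool) \sum_(g : {ffun 'I_n -> bool} | P (frcons g e)) G (frcons g e).
Proof.
by rewrite pair_big_dep /=
  (reindex _ (onW_bij _ (frcons_bij n))).
Qed.

End Masks.

(** * Major index over all placements of a derangement *)

Section Placements.

Variables (E dl : nat -> bool).

(* A mask [b] marks the positions of a word that hold the letters of a derangement [d];
   the others hold fixed points.  [E j] says that letter [j] of [d] is a positive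
   excedance, hence exceeds every adjacent fixed point (otherwise it is below),
   [dl j] that [d] has a descent at [j].  This determines the descents of the word. *)
Definition cnt (b : nat -> bool) p : nat := (\sum_(i < p) b i)%N.

(** Here [cnt b p] is the index in [d] of its letter at position [p], or else of its next letter
    after [p]. *)
Definition pdesc (b : nat -> bool) p : bool :=
  if b p then (if b p.+1 then dl (cnt b p) else E (cnt b p))
  else b p.+1 && ~~ E (cnt b p).

Definition pmaj (b : nat -> bool) n : nat := (\sum_(p < n.-1) pdesc b p * p.+1)%N.

Definition wmaj m : nat := (\sum_(j < m.-1) dl j * j.+1)%N.

Lemma eq_cnt b b' p : (forall k, (k < p)%N -> b k = b' k) -> cnt b p = cnt b' p.
Proof. by move=> bb'; apply: eq_bigr => i _; rewrite bb'. Qed.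

Lemma eq_pmaj b b' n : (forall k, (k < n)%N -> b k = b' k) -> pmaj b n = pmaj b' n.
Proof.
move=> bb'; apply: eq_bigr => p _; rewrite /pdesc.
have lt_p := ltn_ord p.
by rewrite (@eq_cnt b b') ?bb' // => [||k lt_k]; try apply: bb'; lia.
Qed.

Lemma cntS b p : cnt b p.+1 = (cnt b p + b p)%N.
Proof. by rewrite /cnt big_ord_recr. Qed.

Lemma pmajS b n : pmaj b n.+2 = (pmaj b n.+1 + pdesc b n * n.+1)%N.
Proof. by rewrite /pmaj /= big_ord_recr. Qed.

Lemma wmajS m : wmaj m.+2 = (wmaj m.+1 + dl m * m.+1)%N.
Proof. by rewrite /wmaj /= big_ord_recr. Qed.

Variables (R : comNzRingType) (Q : R).

(** The kind [c] of the last position is recorded because it decides the descent made by an appended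
    letter. For [n = 0] the junk value of [fget] makes it a fixed point. *)
Definition psum n m c : R :=
  \sum_(f : {ffun 'I_n -> bool} | (cnt (fget f) n == m) && (fget f n.-1 == c))
    Q ^+ pmaj (fget f) n.

(* The descent between the last letter of a word, of kind [c'], and an appended letter
   of kind [c] (true for letters of [d]), when the word contains [m] letters of [d]. *)
Definition jdesc (c' c : bool) m : bool :=
  if c' then (if c then dl m.-1 else E m.-1) else c && ~~ E m.

Lemma psum_frcons n m c :
  psum n.+1 m c = \sum_(c' : bool)
    \sum_(g : {ffun 'I_n -> bool} | (cnt (fget g) n + c == m)%N && (fget g n.-1 == c'))
      Q ^+ (pmaj (fget g) n + n * jdesc c' c (cnt (fget g) n)).
Proof.
rewrite /psum sum_frcons (bigD1 c) //= [X in _ + X]big1 ?addr0; last first.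
  move=> e ne_ec; apply: big1 => g /andP[_].
  by rewrite fget_frcons ltnn eqxx /= (negPf ne_ec).
rewrite (partition_big (fun g => fget g n.-1) predT) //=; apply: eq_bigr => c' _.
have fgE (g : {ffun 'I_n -> bool}) k : (k < n)%N -> fget (frcons g c) k = fget g k.
  by move=> lt_kn; rewrite fget_frcons lt_kn.
have lastE (g : {ffun 'I_n -> bool}) : fget (frcons g c) n = c.
  by rewrite fget_frcons ltnn eqxx.
apply: eq_big => [g|g /andP[_ /eqP gc']].
  by rewrite cntS (eq_cnt (fgE g)) lastE eqxx andbT.
congr (Q ^+ _); case: n g gc' fgE lastE => [|n] g gc' fgE lastE.
  by rewrite /pmaj /= !big_ord0 mul0n.
rewrite pmajS (eq_pmaj (fgE g)) mulnC; congr (_ + _ * _)%N.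
rewrite /pdesc lastE fgE // gc' [X in jdesc _ _ X]cntS -(eq_cnt (b := fget (frcons g c))).
  by rewrite gc' /jdesc; case: c' gc'; case: c fgE lastE; rewrite ?addn1 ?addn0.
by move=> k lt_kn; rewrite fgE // ltnW.
Qed.

Lemma psum_false n m :
  psum n.+1 m false = \sum_(c : bool) psum n m c * Q ^+ (n * jdesc c false m).
Proof.
rewrite psum_frcons; apply: eq_bigr => c _; rewrite mulr_suml.
apply: eq_big => [g|g /andP[/eqP <- _]]; first by rewrite addn0.
by rewrite addn0 exprD.
Qed.

Lemma psum_true n m :
  psum n.+1 m.+1 true = \sum_(c : bool) psum n m c * Q ^+ (n * jdesc c true m).
Proof.
rewrite psum_frcons; apply: eq_bigr => c _; rewrite mulr_suml.
apply: eq_big => [g|g /andP[/eqP eq_m _]]; first by rewrite addn1 eqSS.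
by rewrite exprD; move: eq_m; rewrite addn1 => -[->].
Qed.

Lemma psum_true0 n : psum n 0 true = 0.
Proof.
case: n => [|n].
  by apply: big1 => f /andP[_]; rewrite fget_out.
rewrite psum_frcons big1 // => c _; apply: big1 => g /andP[].
by rewrite addn1.
Qed.

Lemma psum0 m c : psum 0 m c = ((m == 0%N) && ~~ c)%:R.
Proof.
rewrite /psum (eq_bigr (fun=> 1)) => [|f _]; last by rewrite /pmaj big_ord0.
rewrite sumr_const; congr (_%:R).
rewrite (eq_card (B := if (m == 0%N) && ~~ c then predT else pred0)) => [|f].
  case: ifP => _; last by rewrite card0.
  by rewrite card_ffun card_ord card_bool.
rewrite unfold_in /= /cnt big_ord0 fget_out //.
by case: m c => [|m] [].
Qed.

Hypothesis dlES : forall j, E j -> ~~ E j.+1 -> dl j.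
Hypothesis dlSE : forall j, ~~ E j -> E j.+1 -> ~~ dl j.

(** Induction on the length by appending one position, each case being one of the two q-Pascal
    rules. Only [E m], the kind of the last letter of the derangement, survives in the exponents. *)
Lemma psumE n m :
  [/\ psum n.+1 0 false = 1,
      psum n.+1 m.+1 true
        = Q ^+ (wmaj m.+1 + if E m then 0 else n - m)%N * qbin Q n m
    & psum n.+1 m.+1 false = Q ^+ (wmaj m.+1 + E m * m.+1)%N * qbin Q n m.+1].
Proof.
elim: n m => [|n IH] m.
  rewrite psum_true !psum_false !big_bool !psum0 /= !andbF !andbT /= !mulr0n !mul0r !add0r.
  rewrite !mul0n !expr0 !mulr1 sub0n if_same addn0 mulr0; split=> //.
  by case: m => [|m] /=; rewrite ?mulr0 // mulr1 /wmaj big_ord0.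
have [e0 eT eF] := IH m; rewrite psum_true !psum_false !big_bool /=.
rewrite psum_true0 mul0r add0r e0 !muln0 !expr0 !mulr1; split=> //; last first.
  rewrite eT eF /jdesc /=.
  (* For [n < m] every coefficient involved vanishes; otherwise [n - m] is a true difference and
     [Q ^+ n.+1] splits accordingly. *)
  case: (ltnP n m) => [lt_nm|le_mn].
    by rewrite !qbin_small ?ltnS ?(ltnW lt_nm) // !mulr0 mul0r addr0.
  have nE : Q ^+ n.+1 = Q ^+ (n - m) * Q ^+ m.+1 by rewrite -exprD; congr (_ ^+ _); lia.
  case: (E m); rewrite /= !(mul1n, mul0n, muln0, muln1, addn0, expr0, mulr1);
    by rewrite qbinS_dual // ?nE !exprD; ring.
rewrite /jdesc; case: m {e0 eT eF} => [|m].
  have [-> _ _] := IH 0%N; rewrite psum_true0 mul0r add0r mul1r qbin0 mulr1.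
  by rewrite /wmaj big_ord0; case: (E 0%N); rewrite /= ?muln0 ?muln1 ?subn0.
have [_ -> ->] := IH m; rewrite wmajS /= subSS.
have := dlES (j := m); have := dlSE (j := m).
case: (ltnP n m) => [lt_nm|le_mn].
  by rewrite !qbin_small ?ltnS ?(ltnW lt_nm) // !mulr0 !mul0r addr0.
have nE : Q ^+ n.+1 = Q ^+ (n - m) * Q ^+ m.+1 by rewrite -exprD; congr (_ ^+ _); lia.
(* For letters of different kinds [dlES] and [dlSE] force the value of [dl m]. For equal kinds a
   descent calls for [qbinS_dual], its absence for [qbinS]. *)
case: (E m); case: (E m.+1) => /= dSE dES.
- case: (dl m); rewrite /= !(mul1n, mul0n, muln0, muln1, addn0, expr0, mulr1).
    by rewrite qbinS_dual // nE !exprD; ring.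
  by rewrite qbinS exprD; ring.
- rewrite dES //= !(mul1n, mul0n, muln0, muln1, addn0, expr0, mulr1).
  by rewrite qbinS nE !exprD; ring.
- rewrite (negPf (dSE _ _)) //= !(mul1n, mul0n, muln0, muln1, addn0, expr0, mulr1).
  by rewrite qbinS_dual // exprD; ring.
case: (dl m); rewrite /= !(mul1n, mul0n, muln0, muln1, addn0, expr0, mulr1).
  by rewrite qbinS_dual // nE !exprD; ring.
by rewrite qbinS nE !exprD; ring.
Qed.

End Placements.

(** * Signed permutations and their last letter *)

Section SignedWords.

Definition absv n (s : sword n) k : nat := if insub k is Some i then s.1 i else 0%N.

(* The order [-1 < -2 < ... < 1 < 2 < ...] on letters given by sign bit and absolute
   value; here absolute values are shifted down by one. *)
Definition lettergt (e1 : bool) v1 (e2 : bool) v2 : bool :=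
  if e1 == e2 then (v2 < v1)%N else e2.

Definition sdesc n (s : sword n) k : bool :=
  lettergt (fget s.2 k) (absv s k) (fget s.2 k.+1) (absv s k.+1).

Definition smaj n (s : sword n) : nat := (\sum_(k < n.-1) sdesc s k * k.+1)%N.

(** Appends a letter of sign bit [e] and shifted absolute value [r]. The absolute values of [s] from
    [r] on move up by one, which keeps the descents inside [s]. *)
Definition scons n (r : 'I_n.+1) (e : bool) (s : sword n) : sword n.+1 :=
  (lift_perm ord_max r s.1, frcons s.2 e).

Lemma absv_ord n (s : sword n) (i : 'I_n) : absv s i = s.1 i.
Proof. by rewrite /absv valK. Qed.

Lemma negsE n (s : sword n) : negs s = (\sum_(i < n) s.2 i)%N.
Proof.
rewrite /negs -sum1_card big_mkcond /=; apply: eq_bigr => i _.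
by rewrite inE; case: (s.2 i).
Qed.

Lemma absv_scons n r e (s : sword n) k :
  absv (scons r e s) k = if (k < n)%N then bump r (absv s k) else if k == n then r : nat else 0%N.
Proof.
case: ltngtP => [lt_kn|lt_nk|->].
- rewrite -[X in absv (scons _ _ _) X](lift_max_val (Ordinal lt_kn)) absv_ord.
  by rewrite lift_perm_lift /= -(absv_ord s).
- by rewrite /absv insubN // -leqNgt.
- by rewrite -[X in absv _ X]/(nat_of_ord (@ord_max n)) absv_ord lift_perm_id.
Qed.

Lemma ltn_bump r a b : (bump r a < bump r b)%N = (a < b)%N.
Proof. by rewrite !ltnNge leq_bump2. Qed.

Lemma ltn_bumpl r a : (r < bump r a)%N = (r <= a)%N.
Proof. by rewrite /bump; case: leqP; lia. Qed.

Lemma negs_scons n r e (s : sword n) : negs (scons r e s) = (negs s + e)%N.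
Proof.
rewrite !negsE big_ord_recr /= frcons_max; congr (_ + _)%N.
apply: eq_bigr => i _; rewrite -(frcons_lift s.2 e).
suff -> : widen_ord (leqnSn n) i = lift ord_max i by [].
by apply: val_inj; exact: esym (lift_max_val i).
Qed.

Lemma smaj_scons n r e (s : sword n) :
  smaj (scons r e s) =
    (smaj s + n * lettergt (fget s.2 n.-1) (bump r (absv s n.-1)) e r)%N.
Proof.
case: n r s => [|n] r s; first by rewrite /smaj !big_ord0.
rewrite /smaj /= big_ord_recr /= mulnC; congr (_ + _ * _)%N.
  apply: eq_bigr => k _; congr (nat_of_bool _ * _)%N.
  have lt_k := ltn_ord k.
  by rewrite /sdesc !fget_frcons !absv_scons !ltnS ltnW ?lt_k // /lettergt ltn_bump.
by rewrite /sdesc !fget_frcons !absv_scons !ltnS leqnn ltnn !eqxx.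
Qed.

Lemma odd_scons n r e (s : sword n) :
  odd_perm (scons r e s).1 = odd (n + r) (+) odd_perm s.1.
Proof. by rewrite odd_lift_perm oddD. Qed.

Lemma scons_bij n : bijective (fun u : 'I_n.+1 * (bool * sword n) => scons u.1 u.2.1 u.2.2).
Proof.
apply: inj_card_bij => [[r [e [p g]]] [r' [e' [p' g']]] /= [eq_p eq_g]|]; last first.
  rewrite !card_prod !card_ord !card_ffun !card_ord card_bool expnS.
  by rewrite -!cardsT !cardsT !card_Sn factS; lia.
have eq_r : r = r' by rewrite -(lift_perm_id ord_max r p) eq_p lift_perm_id.
have [-> ->] : e = e' /\ g = g'.
  split; first by rewrite -(frcons_max g e) eq_g frcons_max.
  by apply/ffunP=> j; rewrite -(frcons_lift g e) eq_g frcons_lift.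
rewrite eq_r in eq_p *; congr (_, (_, (_, _))); apply/permP=> i.
by apply: (@lift_inj _ r'); rewrite -(lift_perm_lift ord_max) eq_p lift_perm_lift.
Qed.

Lemma sum_scons (V : nmodType) n (P : pred (sword n.+1)) (G : sword n.+1 -> V) :
  \sum_(s | P s) G s = \sum_(r < n.+1) \sum_(e : bool)
    \sum_(s : sword n | P (scons r e s)) G (scons r e s).
Proof.
under [RHS]eq_bigr => r _ do rewrite pair_big_dep /=.
by rewrite pair_big_dep /= (reindex _ (onW_bij _ (scons_bij n))).
Qed.

End SignedWords.

(** * Signed sums by last letter, without the derangement condition *)

Section LastLetter.

Variables (R : comNzRingType) (q : R).

(** The exponent is fmaj, the sign that of the unsigned permutation. *)
Definition wt n (s : sword n) : R := (-1) ^+ odd_perm s.1 * q ^+ (2 * smaj s + negs s).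

Definition wsum n : R := \sum_(s : sword n) wt s.

Definition lsum n (r : 'I_n.+1) e : R := \sum_(s : sword n) wt (scons r e s).

Lemma wt_scons n r e (s : sword n) :
  wt (scons r e s) = (-1) ^+ (n + r) * q ^+ e * wt s *
    q ^+ (2 * n * lettergt (fget s.2 n.-1) (bump r (absv s n.-1)) e r).
Proof.
rewrite /wt odd_scons negs_scons smaj_scons signr_addb signr_odd.
rewrite mulnDr (mulnA 2 n) !exprD.
set a := q ^+ (2 * smaj s); set b := q ^+ (2 * n * _).
set c := (-1) ^+ n; set d := (-1) ^+ r; set f := (-1) ^+ s.1; ring.
Qed.

Lemma wsumS n : wsum n.+1 = \sum_(r < n.+1) \sum_(e : bool) lsum r e.
Proof. exact: sum_scons. Qed.

(** The descent made by an appended letter depends only on the letter before it, so the sums by last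
    letter satisfy a closed recursion. *)
Lemma lsumS n (r : 'I_n.+2) e :
  lsum r e = (-1) ^+ (n.+1 + r) * q ^+ e *
    \sum_(r' < n.+1) \sum_(e' : bool)
      lsum r' e' * q ^+ (2 * n.+1 * lettergt e' (bump r r') e r).
Proof.
rewrite /lsum sum_scons mulr_sumr; apply: eq_bigr => r' _.
rewrite mulr_sumr; apply: eq_bigr => e' _.
rewrite mulr_suml mulr_sumr; apply: eq_bigr => s _.
rewrite wt_scons /= fget_frcons absv_scons ltnn eqxx /=; ring.
Qed.

Lemma wsum0 : wsum 0 = 1.
Proof.
rewrite /wsum (eq_bigr (fun=> 1)) => [|s _].
  by rewrite sumr_const card_prod card_ffun !card_ord card_bool -cardsT cardsT card_Sn.
rewrite /wt (_ : s.1 = 1%g); last by apply/permP=> -[].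
by rewrite odd_perm1 /smaj negsE !big_ord0 !mul1r.
Qed.

Lemma sum_rev_expr n (z : R) :
  \sum_(i < n.+1) z ^+ (n - i) = \sum_(i < n.+1) z ^+ i.
Proof.
rewrite (reindex_inj rev_ord_inj) /=.
by apply: eq_bigr => i _; rewrite subSS subKn // -ltnS.
Qed.

Lemma sum_above n t (a z : R) : (t <= n)%N ->
  \sum_(i < n) (if (i < t)%N then a else 1) * z ^+ i
  = \sum_(i < n) z ^+ i + (a - 1) * \sum_(i < t) z ^+ i.
Proof.
move=> le_tn; rewrite (big_ord_widen n (fun i => z ^+ i) le_tn) [X in _ * X]big_mkcond.
rewrite mulr_sumr -big_split /=; apply: eq_bigr => i _.
by case: ifP => _; ring.
Qed.

(** Models a preceding letter of rank [i] that makes a descent, of weight [a], exactly when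
    [r <= i]. *)
Lemma sum_ge_rank n r (a z : R) : (r <= n.+1)%N ->
  \sum_(i < n.+1) (if (r <= i)%N then a else 1) * z ^+ (n - i)
  = \sum_(i < n.+1) z ^+ i + (a - 1) * \sum_(i < n.+1 - r) z ^+ i.
Proof.
move=> le_rn; rewrite -sum_above ?leq_subr // (reindex_inj rev_ord_inj) /=.
apply: eq_bigr => i _; have lt_i := ltn_ord i; rewrite !subSS.
have -> : (r <= n - i)%N = (i < n.+1 - r)%N by lia.
by rewrite subKn // -ltnS.
Qed.

(** By induction the preceding letter is distributed geometrically with ratio [z = (-1) ^+ n * q]. A
    descent costs [q ^+ (2 * n.+1)], which is also a power of [z], and the geometric sums then
    collapse to a single power of [z]. *)
Lemma lsumE n (r : 'I_n.+1) e :
  lsum r e = wsum n * q ^+ (n.+1 * e) * ((-1) ^+ n * q) ^+ (n - r).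
Proof.
elim: n r e => [|n IH] r e.
  rewrite /lsum wsum0 (eq_bigr (fun s => q ^+ e * wt s)) => [|s _].
    by rewrite -mulr_sumr -/(wsum 0) wsum0 mul1n mul1r.
  by rewrite wt_scons !mul0n ord1 mul1r mulr1.
rewrite lsumS wsumS.
pose z := (-1) ^+ n * q.
have IHz r' e' : @lsum n r' e' = wsum n * (q ^+ (n.+1 * e') * z ^+ (n - r')).
  by rewrite IH mulrA.
under eq_bigr => r' _.
  under eq_bigr => e' _ do rewrite IHz -!mulrA.
  rewrite -mulr_sumr; over.
under [in RHS]eq_bigr => r' _.
  under eq_bigr => e' _ do rewrite IHz.
  rewrite -mulr_sumr; over.
rewrite -!mulr_sumr /=; set X := \sum_(i < _) _; set Y := \sum_(i < _) _.
suff XY : (-1) ^+ (n.+1 + r) * q ^+ e * X = Y * q ^+ (n.+2 * e) * ((-1) ^+ n.+1 * q) ^+ (n.+1 - r).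
  by rewrite mulrCA XY !mulrA.
have le_r : (r <= n.+1)%N by rewrite -ltnS.
pose T := \sum_(i < n.+1) z ^+ i; pose P := \sum_(i < n.+1 - r) z ^+ i.
have zP : (1 - z) * P = 1 - z ^+ (n.+1 - r) by rewrite -opprB mulNr -subrX1 opprB.
have zT : (1 - z) * T = 1 - z ^+ n.+1 by rewrite -opprB mulNr -subrX1 opprB.
(* The sign disappears because [n * n.+1] is even. *)
have zq : z ^+ n.+1 = q ^+ n.+1.
  rewrite exprMn -exprM -signr_odd (_ : odd (n * n.+1) = false) ?mul1r //.
  by rewrite oddM oddS; case: (odd n).
have YE : Y = (1 + q ^+ n.+1) * T.
  rewrite /Y (eq_bigr (fun i : 'I_n.+1 => (1 + q ^+ n.+1) * z ^+ (n - i))) => [|i _].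
    by rewrite -mulr_sumr sum_rev_expr.
  by rewrite big_bool /= muln1 muln0; ring.
have XE : X = q ^+ (n.+1 * e) * (z ^+ (n.+1 - r) * Y).
  have e2 : q ^+ (2 * n.+1) = z ^+ n.+1 * z ^+ n.+1 by rewrite zq mul2n -addnn exprD.
  rewrite YE -zq /X; clear X; under eq_bigr => i _ do rewrite big_bool /= /lettergt /= ltn_bumpl.
  case: e => /=.
    (* A positive letter before a negative one always makes a descent; between negative letters the
       ranks decide. *)
    rewrite (eq_bigr (fun i : 'I_n.+1 => q ^+ (2 * n.+1) * z ^+ (n - i) +
      q ^+ n.+1 * ((if (r <= i)%N then q ^+ (2 * n.+1) else 1) * z ^+ (n - i)))); last first.
      by move=> i _; case: leqP => _; rewrite /= !muln1 !muln0; ring.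
    rewrite big_split /= -!mulr_sumr sum_ge_rank // -/T -/P muln1.
    rewrite sum_rev_expr -/T.
    rewrite e2 -zq.
    (* Reading [1 - z ^+ n.+1] as [(1 - z) * T] lets [T] factor out and leaves [1 - (1 - z) * P],
       which is [z ^+ (n.+1 - r)]. *)
    transitivity (z ^+ n.+1 * (1 + z ^+ n.+1) * (T - P * (1 - z ^+ n.+1))); first by ring.
    rewrite -zT; transitivity (z ^+ n.+1 * (1 + z ^+ n.+1) * T * (1 - (1 - z) * P)); first by ring.
    by rewrite zP; ring.
  (* A negative letter before a positive one never makes a descent. *)
  rewrite (eq_bigr (fun i : 'I_n.+1 => q ^+ n.+1 * z ^+ (n - i) +
      (if (r <= i)%N then q ^+ (2 * n.+1) else 1) * z ^+ (n - i))); last first.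
    by move=> i _; case: leqP => _; rewrite /= ?muln1 !muln0; ring.
  rewrite big_split /= -!mulr_sumr sum_ge_rank // -/T -/P muln0 expr0.
  rewrite sum_rev_expr -/T.
  rewrite e2 -zq.
  transitivity ((1 + z ^+ n.+1) * (T - P * (1 - z ^+ n.+1))); first by ring.
  rewrite -zT; transitivity ((1 + z ^+ n.+1) * T * (1 - (1 - z) * P)); first by ring.
  by rewrite zP; ring.
have -> : (-1) ^+ n.+1 * q = - z by rewrite exprS mulN1r mulNr.
have -> : (-1) ^+ (n.+1 + r) = (-1) ^+ (n.+1 - r) :> R.
  by rewrite -signr_odd -[RHS]signr_odd oddD oddB.
have -> : q ^+ (n.+2 * e) = q ^+ e * q ^+ (n.+1 * e) by rewrite -exprD mulSn.
by rewrite XE [in RHS]exprNn; ring.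
Qed.

Lemma wsum_rec n :
  wsum n.+1 = wsum n * (1 + q ^+ n.+1) * \sum_(i < n.+1) ((-1) ^+ n * q) ^+ i.
Proof.
rewrite wsumS (reindex_inj rev_ord_inj) mulr_sumr; apply: eq_bigr => r _.
rewrite big_bool !lsumE /= subSS subKn -1?ltnS // muln0 muln1; ring.
Qed.

Lemma lsum_positive n :
  \sum_(r < n.+1 | r != ord_max) lsum r false
  = wsum n * (\sum_(i < n.+1) ((-1) ^+ n * q) ^+ i - 1).
Proof.
rewrite -sum_rev_expr [X in _ * (X - _)](bigD1 ord_max) //= subnn expr0 addrAC subrr add0r mulr_sumr.
by apply: eq_bigr => r _; rewrite lsumE muln0 mulr1.
Qed.

End LastLetter.

(** * Standardization of the non-fixed letters *)

Section PermExtension.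
Local Open Scope group_scope.

Variables (m n : nat) (e : 'I_m -> 'I_n).
Hypothesis e_inj : injective e.

Definition preim_of x : option 'I_m := [pick i | e i == x].

Lemma preim_of_e i : preim_of (e i) = Some i.
Proof.
by rewrite /preim_of; case: pickP => [j /eqP/e_inj->|/(_ i)] //; rewrite eqxx.
Qed.

Lemma preim_of_out x : x \notin codom e -> preim_of x = None.
Proof.
move=> x_out; rewrite /preim_of; case: pickP => // i /eqP ex.
by rewrite -ex codom_f in x_out.
Qed.

Definition ext_fun (p : 'S_m) x := if preim_of x is Some i then e (p i) else x.

Lemma ext_fun_e p i : ext_fun p (e i) = e (p i).
Proof. by rewrite /ext_fun preim_of_e. Qed.

Lemma ext_fun_out p x : x \notin codom e -> ext_fun p x = x.
Proof. by move=> x_out; rewrite /ext_fun preim_of_out. Qed.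

Lemma ext_funK p : cancel (ext_fun p) (ext_fun p^-1).
Proof.
move=> x; case: (boolP (x \in codom e)) => [/codomP[i ->]|x_out].
  by rewrite !ext_fun_e permK.
by rewrite !ext_fun_out.
Qed.

Definition ext_perm p : 'S_n := perm (can_inj (ext_funK p)).

Lemma ext_perm_e p i : ext_perm p (e i) = e (p i).
Proof. by rewrite permE ext_fun_e. Qed.

Lemma ext_perm_out p x : x \notin codom e -> ext_perm p x = x.
Proof. by move=> x_out; rewrite permE ext_fun_out. Qed.

Lemma ext_permM p p' : ext_perm (p * p') = ext_perm p * ext_perm p'.
Proof.
apply/permP=> x; rewrite permM; case: (boolP (x \in codom e)) => [/codomP[i ->]|x_out].
  by rewrite !ext_perm_e permM.
by rewrite !ext_perm_out.
Qed.

Lemma ext_perm_tperm i j : ext_perm (tperm i j) = tperm (e i) (e j).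
Proof.
apply/permP=> x; case: (boolP (x \in codom e)) => [/codomP[k ->]|x_out].
  by rewrite ext_perm_e -inj_tperm.
by rewrite ext_perm_out // tpermD //; apply: contraNneq x_out => <-; apply: codom_f.
Qed.

(** Extension is a morphism that sends transpositions to transpositions, so parity can be read on a
    product of transpositions. *)
Lemma odd_ext_perm p : ext_perm p = p :> bool.
Proof.
have ext1 : ext_perm 1 = 1.
  by apply: (mulgI (ext_perm 1)); rewrite -ext_permM !mulg1.
have [ts -> _] := prod_tpermP p.
elim: ts => [|t ts IH]; first by rewrite big_nil ext1 !odd_perm1.
by rewrite big_cons ext_permM !odd_permM IH ext_perm_tperm !odd_tperm (inj_eq e_inj).
Qed.

End PermExtension.

Lemma mono_inj_ord m n (e : 'I_m -> 'I_n) :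
  (forall i j : 'I_m, (e i < e j)%N = (i < j)%N) -> injective e.
Proof.
move=> e_mono i j eij; apply/eqP; have := e_mono i j; have := e_mono j i.
by rewrite eij ltnn -val_eqE /=; case: ltngtP.
Qed.

(** * Inserting fixed points into a signed derangement *)

Section SignedExtension.

Definition nonfix n (s : sword n) : {set 'I_n} := [set x | s.2 x || (s.1 x != x)].

Definition derange n (s : sword n) : bool := [forall x, s.2 x || (s.1 x != x)].

Lemma eq_sword n (s s' : sword n) : s.1 = s'.1 -> s.2 = s'.2 -> s = s'.
Proof. by case: s s' => [p g] [p' g'] /= -> ->. Qed.

Variables (m n : nat) (e : 'I_m -> 'I_n).
Hypothesis e_mono : forall i j : 'I_m, (e i < e j)%N = (i < j)%N.

Let e_inj : injective e := mono_inj_ord e_mono.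

(** The inverse of standardization: [d] is carried to the image of [e], and all other points are
    positive fixed points. *)
Definition sext (d : sword m) : sword n :=
  (ext_perm e_inj d.1, [ffun x => if preim_of e x is Some i then d.2 i else false]).

Lemma sext1_e d i : (sext d).1 (e i) = e (d.1 i).
Proof. exact: ext_perm_e. Qed.

Lemma sext2_e d i : (sext d).2 (e i) = d.2 i.
Proof. by rewrite ffunE (preim_of_e e_inj). Qed.

Lemma sext1_out d x : x \notin codom e -> (sext d).1 x = x.
Proof. exact: ext_perm_out. Qed.

Lemma sext2_out d x : x \notin codom e -> (sext d).2 x = false.
Proof. by move=> x_out; rewrite ffunE preim_of_out. Qed.

Lemma sext_inj : injective sext.
Proof.
move=> [p g] [p' g'] eq_s; congr (_, _).
  by apply/permP=> i; apply: e_inj; rewrite -(sext1_e (p, g)) eq_s sext1_e.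
by apply/ffunP=> i; rewrite -(sext2_e (p, g)) eq_s sext2_e.
Qed.

Lemma nonfix_sext d : derange d -> nonfix (sext d) = [set x in codom e].
Proof.
move=> /forallP der_d; apply/setP=> x; rewrite !inE.
case: (boolP (x \in codom e)) => [/codomP[i ->]|x_out].
  by rewrite sext1_e sext2_e (inj_eq e_inj) der_d.
by rewrite sext1_out // sext2_out // eqxx.
Qed.

(** The set of non-fixed points is stable: a non-fixed point sent outside it would share its image
    with that image, hence equal it by injectivity. So [s] restricts to a permutation. *)
Lemma sext_surj (s : sword n) : nonfix s = [set x in codom e] ->
  exists2 d, derange d & sext d = s.
Proof.
move=> nf_s.
have nfE x : (x \in codom e) = s.2 x || (s.1 x != x).
  by have /setP/(_ x) := nf_s; rewrite !inE.
have stab i : s.1 (e i) \in codom e.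
  apply: contraT => s_out; have := s_out; rewrite nfE negb_or negbK => /andP[_ /eqP].
  by move/perm_inj=> sei; rewrite sei codom_f in s_out.
pose p0 i := iinv (stab i).
have p0E i : e (p0 i) = s.1 (e i) by rewrite f_iinv.
have p0_inj : injective p0.
  by move=> i j eq_p; apply/e_inj/(@perm_inj _ s.1); rewrite -!p0E eq_p.
exists (perm p0_inj, [ffun i => s.2 (e i)]).
  apply/forallP=> i; rewrite /= ffunE permE -(inj_eq e_inj) p0E -nfE; exact: codom_f.
apply: eq_sword.
  apply/permP=> x; case: (boolP (x \in codom e)) => [/codomP[i ->]|x_out].
    by rewrite ext_perm_e permE p0E.
  by rewrite ext_perm_out //; move: x_out; rewrite nfE negb_or negbK => /andP[_ /eqP].
apply/ffunP=> x; rewrite ffunE.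
case: (boolP (x \in codom e)) => [/codomP[i ->]|x_out].
  by rewrite (preim_of_e e_inj) ffunE.
rewrite preim_of_out //; move: x_out; rewrite nfE negb_or => /andP[gx _].
by rewrite (negPf gx).
Qed.

Variable f : {ffun 'I_n -> bool}.
Hypothesis fE : forall x, f x = (x \in codom e).

(** As [e] is increasing, the marks below [e i] are the images of the indices below [i]. *)
Lemma cnt_e (i : 'I_m) : cnt (fget f) (e i) = i.
Proof.
have le_e : (e i <= n)%N by rewrite ltnW.
rewrite /cnt (big_ord_widen n (fun k => nat_of_bool (fget f k)) le_e).
transitivity (\sum_(x in [set e j | j : 'I_m & (j < i)%N]) 1)%N.
  rewrite [RHS]big_mkcond [LHS]big_mkcond /=; apply: eq_bigr => x _.
  rewrite fget_ord fE; case: (boolP (x \in codom e)) => [/codomP[j ->]|x_out].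
    by rewrite (mem_imset _ _ e_inj) inE e_mono; case: ifP.
  rewrite if_same; case: imsetP => // -[j _ ex].
  by rewrite ex codom_f in x_out.
rewrite sum1_card card_imset // -sum1_card.
rewrite (eq_bigl (fun j : 'I_m => (j < i)%N)) => [|j]; last by rewrite inE.
rewrite -(big_ord_widen m (fun=> 1%N)) ?(ltnW (ltn_ord i)) //.
by rewrite sum_nat_const card_ord muln1.
Qed.

(** Past the end of the word [absv] is [0], so no excedance occurs there. *)
Definition excedance (d : sword m) j := ~~ fget d.2 j && (j < absv d j)%N.

(** The delicate comparisons are those of a letter of [d] with an adjacent fixed point. Since [e]
    misses the fixed point, comparing with it amounts to comparing with the letter's own position,
    which is the excedance condition. *)
Lemma sdesc_sext d p : derange d -> (p.+1 < n)%N ->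
  sdesc (sext d) p = pdesc (excedance d) (sdesc d) (fget f) p.
Proof.
move=> /forallP der_d lt_p1.
have [x xp] : exists x : 'I_n, p = x by exists (Ordinal (ltnW lt_p1)).
have [y yp] : exists y : 'I_n, p.+1 = y by exists (Ordinal lt_p1).
have xy : y = x.+1 :> nat by rewrite -yp xp.
rewrite /sdesc /pdesc xp -xp yp xp !fget_ord !absv_ord !fE.
case: (boolP (x \in codom e)) => [/codomP[i ex]|x_out];
  case: (boolP (y \in codom e)) => [/codomP[j ey]|y_out] /=.
- have ij : j = i.+1 :> nat.
    by rewrite -(cnt_e j) -ey -yp cntS xp ex cnt_e fget_ord fE codom_f addn1.
  rewrite ex ey !sext2_e !sext1_e cnt_e /sdesc -ij !fget_ord !absv_ord.
  by rewrite /lettergt e_mono.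
- rewrite ex sext2_e sext1_e (sext1_out _ y_out) (sext2_out _ y_out) cnt_e.
  rewrite /excedance fget_ord absv_ord /lettergt; case: (d.2 i) => //=.
  (* As [y = x + 1] is not a value of [e], exceeding [y] is the same as exceeding [x]. *)
  rewrite xy ex -[RHS]e_mono ltn_neqAle.
  case: eqP => //= eq_y; exfalso; move/negP: y_out; apply.
  by rewrite (_ : y = e (d.1 i)) ?codom_f //; apply: val_inj; rewrite /= xy ex.
- rewrite ey sext2_e sext1_e (sext1_out _ x_out) (sext2_out _ x_out) /=.
  have -> : cnt (fget f) x = j.
    by rewrite -(cnt_e j) -ey -yp cntS xp fget_ord fE (negPf x_out) addn0.
  rewrite /excedance fget_ord absv_ord /lettergt.
  case: (boolP (d.2 j)) => //= /negPf pos_j; have := der_d j; rewrite pos_j /= => ne_j.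
  (* The bounds differ by one, and [x] is not a value of [e]. *)
  have -> : (e (d.1 j) < x)%N = (e (d.1 j) < y)%N.
    rewrite xy [RHS]ltnS [RHS]leq_eqVlt; case: eqP => //= eq_x; exfalso; move/negP: x_out; apply.
    by rewrite (_ : x = e (d.1 j)) ?codom_f //; apply: val_inj; rewrite /= eq_x.
  by rewrite ey e_mono -leqNgt ltn_neqAle ne_j.
by rewrite (sext1_out _ x_out) (sext2_out _ x_out) (sext1_out _ y_out) (sext2_out _ y_out)
  /lettergt eqxx xy ltnNge leqnSn.
Qed.

Lemma smaj_sext d : derange d ->
  smaj (sext d) = pmaj (excedance d) (sdesc d) (fget f) n.
Proof.
move=> der_d; apply: eq_bigr => p _; rewrite sdesc_sext //.
by have := ltn_ord p; lia.
Qed.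

Lemma negs_sext d : negs (sext d) = negs d.
Proof.
rewrite !negsE (bigID (mem (codom e))) /= [X in (_ + X)%N]big1 => [|x x_out].
  rewrite addn0 (eq_bigl (mem [set e i | i : 'I_m])) => [|x].
    rewrite big_imset /=; last by move=> i j _ _ /e_inj.
    by apply: eq_bigr => i _; rewrite sext2_e.
  by apply/codomP/imsetP => [[i ->]|[i _ ->]]; exists i.
by rewrite sext2_out.
Qed.

Lemma odd_sext d : odd_perm (sext d).1 = d.1.
Proof. exact: odd_ext_perm. Qed.

End SignedExtension.

(** * Sorting signed permutations by their non-fixed points *)

Section Decomposition.

Definition mask_set n (f : {ffun 'I_n -> bool}) : {set 'I_n} := [set x | f x].

Definition support_emb n (f : {ffun 'I_n -> bool}) (i : 'I_#|mask_set f|) : 'I_n :=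
  enum_val i.

(** The enumeration of a set of ordinals is a subsequence of the increasing list of all ordinals. *)
Lemma support_emb_mono n (f : {ffun 'I_n -> bool}) (i j : 'I_#|mask_set f|) :
  (support_emb i < support_emb j)%N = (i < j)%N.
Proof.
pose s := map val (enum (mask_set f)).
have mono a b : (a < b)%N -> (b < #|mask_set f|)%N -> (nth 0%N s a < nth 0%N s b)%N.
  move=> lt_ab lt_b; apply: (sorted_ltn_nth ltn_trans); rewrite ?inE ?size_map -?cardE //.
    rewrite /s /enum_mem -enumT -[X in sorted _ X]/(map val (filter _ _)).
    apply: (subseq_sorted ltn_trans (map_subseq _ (filter_subseq _ _))).
    by rewrite val_enum_ord iota_ltn_sorted.
  exact: ltn_trans lt_b.
have embE (k : 'I_#|mask_set f|) : support_emb k = nth 0%N s k :> nat.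
  by rewrite (nth_map (support_emb k)) -?cardE // -enum_val_nth.
have lt_i := ltn_ord i; have lt_j := ltn_ord j; rewrite !embE.
case: (ltngtP i j) => [lt_ij|lt_ji|->]; last by rewrite ltnn.
  by rewrite mono.
by apply/negbTE; rewrite -leqNgt ltnW // mono.
Qed.

Lemma support_embP n (f : {ffun 'I_n -> bool}) x : f x = (x \in codom (@support_emb n f)).
Proof.
apply/idP/codomP => [fx|[i ->]]; last first.
  by have := enum_valP i; rewrite inE.
have xf : x \in mask_set f by rewrite inE.
by exists (enum_rank_in xf x); rewrite /support_emb enum_rankK_in.
Qed.

(** For each mask [f], [sext] is a bijection from the derangements of its size onto the signed
    permutations whose non-fixed points are those marked by [f]. *)
Lemma sum_derange (V : nmodType) n (P : pred (sword n)) (G : sword n -> V) :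
  \sum_(s | P s) G s = \sum_(f : {ffun 'I_n -> bool})
    \sum_(d : sword #|mask_set f| | derange d && P (sext (@support_emb_mono n f) d))
      G (sext (@support_emb_mono n f) d).
Proof.
pose mask (s : sword n) := [ffun x => s.2 x || (s.1 x != x)].
rewrite (partition_big mask predT) //=; apply: eq_bigr => f _.
set h := sext (@support_emb_mono n f).
have maskP s : (mask s == f) = (nonfix s == [set x in codom (@support_emb n f)]).
  apply/eqP/eqP => [mf|/setP nf].
    by apply/setP=> x; rewrite !inE -support_embP -mf ffunE.
  by apply/ffunP=> x; have := nf x; rewrite !inE -support_embP ffunE.
rewrite (eq_bigl (mem (h @: [set d | derange d && P (h d)]))) => [|s].
  rewrite big_imset /=; last by move=> d d' _ _ /sext_inj.
  by apply: eq_bigl => d; rewrite inE.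
rewrite maskP; apply/andP/imsetP => [[Ps /eqP nf_s]|[d]].
  have [d der_d hd] := sext_surj (@support_emb_mono n f) nf_s.
  by exists d; rewrite // inE der_d /h hd.
by rewrite inE => /andP[der_d Pd] ->; rewrite Pd nonfix_sext.
Qed.

End Decomposition.

(** * Sums over derangements *)

Section DerangementSums.

Lemma absv_lt n (s : sword n) k : (k < n)%N -> (absv s k < n)%N.
Proof. by move=> lt_k; rewrite -[k]/(val (Ordinal lt_k)) absv_ord. Qed.

Lemma absv_out n (s : sword n) k : (n <= k)%N -> absv s k = 0%N.
Proof. by move=> le_nk; rewrite /absv insubN // -leqNgt. Qed.

Lemma derange_absv n (s : sword n) k :
  derange s -> (k < n)%N -> ~~ fget s.2 k -> absv s k != k.
Proof.
move=> /forallP der_s lt_k; rewrite -[k]/(val (Ordinal lt_k)) absv_ord fget_ord => /negPf sk.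
by have := der_s (Ordinal lt_k); rewrite sk.
Qed.

(** The shifted value at [j] exceeds [j], whereas a positive non-excedance at [j.+1], not being
    fixed, has value at most [j]; a negative letter there makes a descent anyway. *)
Lemma excedance_desc n (d : sword n) j : derange d ->
  excedance d j -> ~~ excedance d j.+1 -> sdesc d j.
Proof.
move=> der_d /andP[/negPf pos_j exc_j]; rewrite /sdesc /lettergt /excedance pos_j.
case: (boolP (fget d.2 j.+1)) => //= pos_j1; rewrite -leqNgt => le_j1.
have [le_n|lt_n] := leqP n j.+1; first by rewrite absv_out //; lia.
by have := derange_absv der_d lt_n pos_j1; lia.
Qed.

Lemma excedance_ndesc n (d : sword n) j :
  ~~ excedance d j -> excedance d j.+1 -> ~~ sdesc d j.
Proof.
rewrite /excedance /sdesc /lettergt => nexc_j /andP[/negPf-> exc_j1].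
by move: nexc_j; case: (fget d.2 j) => //=; lia.
Qed.

(** Selects the branch of [psumE] where [E m] is false. *)
Lemma excedance_last n (d : sword n.+1) : excedance d n = false.
Proof. by rewrite /excedance [(n < _)%N]leqNgt absv_lt // andbF. Qed.

Variables (R : comNzRingType) (q : R).

Definition dersum n : R := \sum_(d : sword n | derange d) wt q d.

Definition dersum_pos n : R :=
  \sum_(d : sword n | derange d && ~~ fget d.2 n.-1) wt q d.

(** The index is one less than the length, because the last position will always be marked and only
    the other [n] are free. *)
Definition wsum_pos n : R :=
  \sum_(s : sword n.+1 | ~~ s.2 ord_max && (s.1 ord_max != ord_max)) wt q s.

Lemma cnt_mask n (f : {ffun 'I_n -> bool}) : cnt (fget f) n = #|mask_set f|.
Proof.
rewrite /cnt -sum1_card [RHS]big_mkcond /=; apply: eq_bigr => i _.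
by rewrite fget_ord inE; case: (f i).
Qed.

(** The type of [d] depends on [f], so the sums can be exchanged only after the masks are grouped by
    their number of marks. *)
Lemma sum_by_support (V : nmodType) n (P : forall m, pred (sword m))
    (G : forall m, sword m -> {ffun 'I_n -> bool} -> V) :
  \sum_(f : {ffun 'I_n -> bool}) \sum_(d : sword #|mask_set f| | P _ d) G _ d f
  = \sum_(m < n.+1) \sum_(d : sword m | P _ d)
      \sum_(f : {ffun 'I_n -> bool} | cnt (fget f) n == m) G _ d f.
Proof.
have lt_mask (f : {ffun 'I_n -> bool}) : (#|mask_set f| < n.+1)%N.
  by rewrite ltnS -[X in (_ <= X)%N]card_ord max_card.
rewrite (partition_big (fun f => Ordinal (lt_mask f)) predT) //=.
apply: eq_bigr => m _; rewrite exchange_big /=.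
apply: eq_big => [f|f /eqP <- //]; by rewrite cnt_mask.
Qed.

Lemma wt_sext m n (e : 'I_m -> 'I_n) (e_mono : forall i j : 'I_m, (e i < e j)%N = (i < j)%N)
    (f : {ffun 'I_n -> bool}) (d : sword m) :
  (forall x, f x = (x \in codom e)) -> derange d ->
  wt q (sext e_mono d) =
    (-1) ^+ odd_perm d.1 * q ^+ negs d *
    (q ^+ 2) ^+ pmaj (excedance d) (sdesc d) (fget f) n.
Proof.
move=> fE der_d; rewrite /wt odd_sext negs_sext (smaj_sext e_mono fE) //.
by rewrite exprD exprM -mulrA [X in _ * X = _]mulrC.
Qed.

Lemma sum_psum n m E dl (c : R) (Q : R) :
  \sum_(f : {ffun 'I_n -> bool} | cnt (fget f) n == m) c * Q ^+ pmaj E dl (fget f) n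
  = c * \sum_(b : bool) psum E dl Q n m b.
Proof.
rewrite -mulr_sumr; congr (_ * _).
by rewrite (partition_big (fun f => fget f n.-1) predT).
Qed.

Lemma wsum_dersum n :
  wsum q n = \sum_(m < n.+1) qbin (q ^+ 2) n m * dersum m.
Proof.
rewrite /wsum sum_derange.
transitivity (\sum_(f : {ffun 'I_n -> bool}) \sum_(d : sword #|mask_set f| | derange d)
    (-1) ^+ odd_perm d.1 * q ^+ negs d *
    (q ^+ 2) ^+ pmaj (excedance d) (sdesc d) (fget f) n).
  apply: eq_bigr => f _; rewrite (eq_bigl (@derange _)) => [|d]; last by rewrite andbT.
  by apply: eq_bigr => d der_d; apply: wt_sext => // x; exact: support_embP.
rewrite (sum_by_support (fun m => @derange m) (fun m d f => (-1) ^+ odd_perm d.1 * q ^+ negs d *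
    (q ^+ 2) ^+ pmaj (excedance d) (sdesc d) (fget f) n)).
apply: eq_bigr => m _; rewrite mulr_sumr; apply: eq_bigr => d der_d.
rewrite sum_psum.
suff -> : \sum_(b : bool) psum (excedance d) (sdesc d) (q ^+ 2) n m b
    = (q ^+ 2) ^+ smaj d * qbin (q ^+ 2) n m.
  rewrite /wt exprD exprM; set a := (-1) ^+ _; set b := q ^+ negs d.
  by set c := (q ^+ 2) ^+ smaj d; ring.
case: n m d der_d => [|n] [m lt_m] d der_d; rewrite big_bool /=.
  case: m lt_m d der_d => // lt_m d der_d.
  by rewrite !psum0 /smaj big_ord0 /= mulr0n add0r qbin0 mulr1.
have Hes := @excedance_desc _ _ _ der_d; have Hse := @excedance_ndesc _ d.
case: m lt_m d der_d Hes Hse => [|m] lt_m d der_d Hes Hse.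
  have [-> _ _] := psumE (q ^+ 2) (fun j => @Hes j) (fun j => @Hse j) n 0.
  by rewrite psum_true0 add0r qbin0 /smaj big_ord0 mulr1.
have [_ -> ->] := psumE (q ^+ 2) (fun j => @Hes j) (fun j => @Hse j) n m.
(* The last letter is no excedance, so the sums for the two kinds of last position add up by the
   dual q-Pascal rule. *)
by rewrite excedance_last mul0n addn0 exprD -[wmaj _ _]/(smaj d) qbinS_dual // mulrDr mulrA.
Qed.

(** A marked top position carries the last letter of [d], which is not fixed when positive; an
    unmarked one is itself a fixed point. *)
Lemma fget_sext_max n (f : {ffun 'I_n.+1 -> bool}) (d : sword #|mask_set f|) :
  let s := sext (@support_emb_mono _ f) d in
  derange d ->
  ~~ s.2 ord_max && (s.1 ord_max != ord_max)
  = fget f n && ~~ fget d.2 #|mask_set f|.-1.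
Proof.
move=> s der_d; rewrite -[n in fget f n]/(nat_of_ord (@ord_max n)) fget_ord support_embP.
case: (boolP (_ \in _)) => [/codomP[i ei]|max_out]; last first.
  by rewrite /s sext1_out // eqxx andbF.
have card_f : #|mask_set f| = i.+1.
  have := cnt_e (@support_emb_mono _ f) (@support_embP _ f) i; rewrite -ei /= => cnt_i.
  transitivity (cnt (fget f) n.+1); first by rewrite cnt_mask.
  rewrite cntS cnt_i -[X in fget f X]/(nat_of_ord (@ord_max n)) fget_ord.
  by rewrite support_embP ei codom_f addn1.
have i_last : i = #|mask_set f|.-1 :> nat by rewrite [in RHS]card_f.
rewrite -i_last fget_ord /s ei sext2_e sext1_e.
case: (boolP (d.2 i)) => //= /negPf pos_i.
have /forallP/(_ i) := der_d; rewrite pos_i /= => ne_i.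
by apply: contraNneq ne_i => /(mono_inj_ord (@support_emb_mono _ f)) ->.
Qed.

(** Here the last position is marked, so only the second formula of [psumE] contributes, with its
    extra power for a final non-excedance. *)
Lemma wsum_pos_dersum n :
  wsum_pos n = \sum_(m < n.+1) (q ^+ 2) ^+ (n - m) * qbin (q ^+ 2) n m * dersum_pos m.+1.
Proof.
(* The condition on the mask goes into the summand, since [sum_by_support] filters on [d] alone. *)
pose G m (d : sword m) (f : {ffun 'I_n.+1 -> bool}) : R := if fget f n then
  (-1) ^+ odd_perm d.1 * q ^+ negs d *
    (q ^+ 2) ^+ pmaj (excedance d) (sdesc d) (fget f) n.+1 else 0.
pose P m (d : sword m) := derange d && ~~ fget d.2 m.-1.
rewrite /wsum_pos sum_derange.
transitivity (\sum_(f : {ffun 'I_n.+1 -> bool}) \sum_(d : sword #|mask_set f| | P _ d) G _ d f).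
  apply: eq_bigr => f _; case: (boolP (fget f n)) => [f_max|/negPf f_max]; last first.
    rewrite [RHS]big1 => [|d _]; last by rewrite /G f_max.
    apply: big_pred0 => d; case: (boolP (derange d)) => //= der_d.
    by rewrite fget_sext_max // f_max.
  apply: eq_big => [d|d /andP[der_d _]].
    by rewrite /P; case: (boolP (derange d)) => //= der_d; rewrite fget_sext_max // f_max.
  by rewrite /G f_max; apply: wt_sext => // x; exact: support_embP.
rewrite (sum_by_support P G) big_ord_recl [X in X + _]big1 ?add0r => [|d _]; last first.
  rewrite /G -big_mkcondr /= (eq_bigl (fun f => (cnt (fget f) n.+1 == 0%N) && (fget f n == true))).
    by rewrite -mulr_sumr -/(psum _ _ _ n.+1 0 true) psum_true0 mulr0.
  by move=> f; rewrite eqb_id.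
apply: eq_bigr => m _; rewrite mulr_sumr; apply: eq_bigr => d /andP[der_d _].
rewrite /G -big_mkcondr /= (eq_bigl (fun f => (cnt (fget f) n.+1 == m.+1) && (fget f n == true))).
  have Hes := @excedance_desc _ _ _ der_d; have Hse := @excedance_ndesc _ d.
  have [_ E _] := psumE (q ^+ 2) (fun j => @Hes j) (fun j => @Hse j) n m.
  rewrite -mulr_sumr -/(psum (excedance d) (sdesc d) (q ^+ 2) n.+1 m.+1 true) E.
  rewrite excedance_last exprD -[wmaj _ _]/(smaj d) /wt exprD exprM.
  set a := (-1) ^+ _; set b := q ^+ negs d; set c := (q ^+ 2) ^+ smaj d; set e := _ ^+ (n - m).
  by ring.
by move=> f; rewrite eqb_id.
Qed.

Lemma wsum_posE n :
  wsum_pos n = wsum q n * (\sum_(i < n.+1) ((-1) ^+ n * q) ^+ i - 1).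
Proof.
rewrite -lsum_positive /wsum_pos sum_scons [RHS]big_mkcond /=; apply: eq_bigr => r _.
rewrite big_bool /= big_pred0 ?add0r => [|s]; last by rewrite frcons_max.
case: (boolP (r == ord_max)) => [/eqP ->|ne_r] /=.
  by rewrite big_pred0 // => s; rewrite lift_perm_id eqxx andbF.
by apply: eq_bigl => s; rewrite lift_perm_id ne_r frcons_max.
Qed.

End DerangementSums.

(** * Reduction of the type D statistics *)

Section Length.

(* The usual order of the integers on the same encoded letters. *)
Definition lettergt_int (e1 : bool) v1 (e2 : bool) v2 : bool :=
  if e1 then e2 && (v1 < v2)%N else e2 || (v2 < v1)%N.

Lemma sletter_lt n (s : sword n) i j :
  (sletter s j < sletter s i) = lettergt_int (s.2 i) (s.1 i) (s.2 j) (s.1 j).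
Proof. by rewrite /sletter /lettergt_int; case: (s.2 i); case: (s.2 j); lia. Qed.

Definition lengthB n (s : sword n) : nat :=
  (Defs.inv s + \sum_(i < n) s.2 i * (s.1 i).+1)%N.

Lemma ellB_lengthB n (s : sword n) : ellB s = (lengthB s)%:Z.
Proof.
rewrite /ellB /lengthB PoszD; congr (_ + _).
rewrite -sumrN big_mkcond /= (big_morph Posz PoszD (erefl 0%:Z)); apply: eq_bigr => i _.
by rewrite /sletter; case: (s.2 i); rewrite ?mul0n // mul1n opprK.
Qed.

Lemma invE n (s : sword n) :
  Defs.inv s = (\sum_(j < n) \sum_(i < j)
    lettergt_int (fget s.2 i) (absv s i) (fget s.2 j) (absv s j))%N.
Proof.
rewrite /Defs.inv -sum1_card.
pose P (i j : 'I_n) := (i < j)%N && (sletter s j < sletter s i).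
rewrite (eq_bigl (fun ij => P ij.1 ij.2)) => [|ij]; last by rewrite inE.
rewrite -(pair_big_dep predT P (fun _ _ => 1%N)) /=.
rewrite (exchange_big_dep predT) //=; apply: eq_bigr => j _.
pose F k := nat_of_bool (lettergt_int (fget s.2 k) (absv s k) (fget s.2 j) (absv s j)).
rewrite -/(\sum_(i < j) F i)%N (big_ord_widen n F) ?(ltnW (ltn_ord j)) //.
rewrite big_mkcondr; apply: eq_bigr => i _.
by rewrite /F !fget_ord !absv_ord sletter_lt; case: (lettergt_int _ _ _ _).
Qed.

Lemma inv_scons n r e (s : sword n) :
  Defs.inv (scons r e s) =
    (Defs.inv s + \sum_(i < n) lettergt_int (s.2 i) (bump r (s.1 i)) e r)%N.
Proof.
rewrite !invE big_ord_recr /=; congr (_ + _)%N.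
  apply: eq_bigr => j _; apply: eq_bigr => i _; have lt_j := ltn_ord j.
  rewrite !fget_frcons !absv_scons lt_j (ltn_trans (ltn_ord i)) //.
  by rewrite /lettergt_int !ltn_bump.
apply: eq_bigr => i _; rewrite !fget_frcons !absv_scons ltn_ord ltnn eqxx /=.
by rewrite fget_ord absv_ord.
Qed.

Lemma sum_ge_perm n (p : 'S_n) r : (r <= n)%N ->
  (\sum_(i < n) (r <= p i)%N = n - r)%N.
Proof.
move=> le_rn; rewrite (reindex_perm p^-1) /=.
rewrite (eq_bigr (fun i : 'I_n => nat_of_bool (r <= i)%N)) => [|i _]; last by rewrite permKV.
rewrite (reindex_inj rev_ord_inj) /=.
transitivity (\sum_(i < n | (i < n - r)%N) 1)%N.
  rewrite [RHS]big_mkcond; apply: eq_bigr => i _; have lt_i := ltn_ord i.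
  have -> : (r <= n - i.+1)%N = (i < n - r)%N by lia.
  by case: ifP.
by rewrite -(big_ord_widen n (fun=> 1%N)) ?leq_subr // sum_nat_const card_ord muln1.
Qed.

(** An old letter adds to the length by an inversion with the new one or, if negative, by the growth
    of its absolute value. Whatever its sign, the total is one when [e] holds, and otherwise one
    exactly when its shifted value is at least [r]. *)
Lemma lengthB_scons n r e (s : sword n) :
  lengthB (scons r e s) = (lengthB s + if e then n + r.+1 else n - r)%N.
Proof.
have le_r : (r <= n)%N by rewrite -ltnS.
rewrite /lengthB inv_scons big_ord_recr /=.
have widenE (i : 'I_n) : widen_ord (leqnSn n) i = lift ord_max i.
  by apply: val_inj; exact: esym (lift_max_val i).
rewrite frcons_max lift_perm_id.
rewrite [X in (_ + (X + _))%N](eq_bigr (fun i => s.2 i * (bump r (s.1 i)).+1)%N) => [|i _]; last first.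
  by rewrite widenE frcons_lift lift_perm_lift.
set a := Defs.inv s; set b := (\sum_(i < n) s.2 i * (s.1 i).+1)%N.
suff E : (\sum_(i < n) lettergt_int (s.2 i) (bump r (s.1 i)) e r +
    \sum_(i < n) s.2 i * (bump r (s.1 i)).+1 = b + if e then n else n - r)%N.
  by rewrite -addnA (addnA _ _ (e * _)%N) E; case: (e); rewrite /= ?mul0n ?mul1n; lia.
case: e; last first.
  rewrite -[X in (_ = _ + X)%N](sum_ge_perm s.1 le_r) -!big_split /=.
  apply: eq_bigr => i _; rewrite /lettergt_int /bump.
  by case: (s.2 i); case: (leqP r (s.1 i)) => /=; lia.
rewrite -[X in (_ = _ + X)%N](card_ord n) -sum1_card -!big_split /=.
apply: eq_bigr => i _; rewrite /lettergt_int /bump.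
by case: (s.2 i); case: (leqP r (s.1 i)) => /=; lia.
Qed.

(** Appending a letter changes the parity of the length by [n + r + e], that of the permutation by
    [n + r], and that of [negs] by [e]. *)
Lemma odd_lengthB n (s : sword n) : odd (lengthB s) = odd_perm s.1 (+) odd (negs s).
Proof.
elim: n s => [|n IH] s.
  rewrite /lengthB invE negsE !big_ord0 (_ : s.1 = 1%g) ?odd_perm1 //.
  by apply/permP=> -[].
have [g _ gK] := scons_bij n; rewrite -(gK s); case: (g s) => r [e d] /=.
have le_r : (r <= n)%N by rewrite -ltnS.
have IHd := IH d; rewrite lengthB_scons (odd_scons r e d); move: (lengthB d) IHd => l IHd.
rewrite negs_scons !oddD IHd.
case: e => /=; rewrite ?oddD ?(oddB le_r) /=;
  by case: (odd n); case: (odd r); case: (odd (negs d)); case: (odd_perm d.1).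
Qed.

Lemma sign_ellD (K : fieldType) n (s : sword n) : inD s ->
  (-1) ^ ellD s = (-1) ^+ odd_perm s.1 :> K.
Proof.
rewrite /inD => even_neg; rewrite /ellD ellB_lengthB.
have le_neg : (negs s <= lengthB s)%N.
  rewrite negsE /lengthB (leq_trans _ (leq_addl _ _)) // leq_sum // => i _.
  by case: (s.2 i); lia.
rewrite subzn // -exprnP -(signr_odd _ (lengthB s - negs s)) oddB // odd_lengthB (negPf even_neg).
by rewrite addbF addbF.
Qed.

End Length.

Section Statistics.

Lemma sletter_fix n (s : sword n) (i : 'I_n) :
  (sletter s i != (i.+1)%N%:Z) = s.2 i || (s.1 i != i).
Proof.
rewrite /sletter; case: (s.2 i) => /=; first by lia.
by rewrite -val_eqE /=; lia.
Qed.

Lemma inDD_derange n (s : sword n) : inDD s = inD s && derange s.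
Proof. by rewrite /inDD; congr (_ && _); apply: eq_forallb => i; exact: sletter_fix. Qed.

Lemma prec_gtE (e1 e2 : bool) (v1 v2 : nat) :
  prec_gt (if e1 then - (v1.+1)%:Z else v1.+1%:Z) (if e2 then - (v2.+1)%:Z else v2.+1%:Z)
  = lettergt e1 v1 e2 v2.
Proof. by rewrite /prec_gt /lettergt; case: e1; case: e2 => /=; lia. Qed.

Lemma dwordE n (s : sword n) r e k : (k <= n)%N ->
  dword (scons r e s) k =
    let t := scons r false s in
    if fget t.2 k then - ((absv t k).+1)%:Z else ((absv t k).+1)%:Z.
Proof.
move=> le_kn; rewrite /dword /=.
have lt_k : (k < n.+1)%N by [].
have -> : sletter_nat (scons r e s) k =
    if fget (frcons s.2 e) k then - ((absv (scons r e s) k).+1)%:Z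
    else ((absv (scons r e s) k).+1)%:Z.
  by rewrite /sletter_nat /fget /absv insubT.
rewrite !fget_frcons !absv_scons; case: eqP => [->|/eqP ne_kn].
  by rewrite ltnn andbF; case: (e).
by rewrite ltn_neqAle ne_kn le_kn.
Qed.

(** Dmaj sees the word with its last sign removed, so the value does not depend on [e]. *)
Lemma Dmaj_scons n r e (s : sword n) :
  Dmaj (scons r e s) = (2 * smaj (scons r false s) + negs s)%N.
Proof.
rewrite /Dmaj; congr (2 * _ + _)%N.
  rewrite /dmaj_prec big_mkord big_mkcond /=; apply: eq_bigr => k _; have lt_k := ltn_ord k.
  rewrite !dwordE ?(ltnW lt_k) //= prec_gtE -/(sdesc (scons r false s) k).
  by case: (sdesc _ _); rewrite ?mul1n.
transitivity (negs (scons r false s)); last by rewrite negs_scons addn0.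
rewrite negsE /dneg big_mkord big_mkcond /=; apply: eq_bigr => k _.
by rewrite dwordE -1?ltnS //= fget_ord; case: (frcons s.2 false k).
Qed.

Lemma derange_scons n r e (s : sword n) :
  derange (scons r e s) = (e || (r != ord_max)) &&
    [forall j, s.2 j || (lift r (s.1 j) != lift ord_max j)].
Proof.
apply/forallP/andP => [der_s|[max_ok /forallP der_s] x].
  split; first by have := der_s ord_max; rewrite /= frcons_max lift_perm_id.
  by apply/forallP=> j; have := der_s (lift ord_max j); rewrite /= frcons_lift lift_perm_lift.
case: (unliftP ord_max x) => [j|] -> /=; first by rewrite frcons_lift lift_perm_lift.
by rewrite frcons_max lift_perm_id.
Qed.

Lemma derange_scons_max n e (s : sword n) :
  derange (scons ord_max e s) = e && derange s.
Proof.
rewrite derange_scons eqxx orbF; congr (_ && _).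
by apply: eq_forallb => j; rewrite (inj_eq (@lift_inj _ _)).
Qed.

End Statistics.

(** * From type D derangements to sums over signed derangements *)

Section TypeD.

Variables (K : fieldType) (q : K).

(** The largest letter, appended as positive, makes no descent, and the sign exponent [n + n] is
    even. *)
Lemma wt_scons_max n (s : sword n) : wt q (scons ord_max false s) = wt q s.
Proof.
rewrite wt_scons /lettergt ltn_bumpl addnn -signr_odd odd_double expr0 !mul1r.
case: n s => [|n] s; first by rewrite mul0n mulr1.
by case: (fget _ _) => /=; rewrite ?[(n.+1 <= _)%N]leqNgt ?absv_lt // muln0 mulr1.
Qed.

(** Evenness of [negs] forces the sign of the last letter to be [odd (negs s)], while the weight is
    that of the word with this letter made positive. *)
Lemma sum_inDD n :
  \sum_(s : sword n.+1 | inDD s) (-1) ^ (ellD s) * q ^+ Dmaj s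
  = dersum_pos q n.+1 + \sum_(s : sword n | derange s && odd (negs s)) wt q s.
Proof.
pose P r (s : sword n) := derange (scons r (odd (negs s)) s).
transitivity (\sum_(r < n.+1) \sum_(s | P r s) wt q (scons r false s)).
  rewrite sum_scons; apply: eq_bigr => r _.
  rewrite (exchange_big_dep (P r)) /= => [|e s _]; last first.
    by rewrite inDD_derange /inD negs_scons oddD /P; case: (odd _); case: e.
  apply: eq_bigr => s Ps; rewrite (big_pred1 (odd (negs s))) => [|e].
    rewrite sign_ellD; last by rewrite /inD negs_scons oddD; case: (odd _).
    by rewrite Dmaj_scons /wt negs_scons addn0 !odd_scons.
  rewrite inDD_derange /inD negs_scons oddD /P.
  by move: Ps; rewrite /P; case: (odd _); case: e => //= ->.
(* A last letter of maximal absolute value must be negative, hence [negs s] odd; any other one is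
   unrestricted in sign and yields [dersum_pos]. *)
rewrite (bigD1 ord_max) //= addrC; congr (_ + _); last first.
  apply: eq_big => [s|s _]; last exact: wt_scons_max.
  by rewrite /P derange_scons_max andbC.
rewrite /dersum_pos sum_scons [RHS](bigD1 ord_max) //= [X in _ = X + _]big1 ?add0r => [|e _].
  apply: eq_bigr => r ne_r; rewrite big_bool /= [X in _ = X + _]big_pred0 ?add0r => [|s].
    apply: eq_bigl => s; rewrite /P !derange_scons ne_r orbT.
    by rewrite fget_frcons ltnn andbF andbT.
  by rewrite fget_frcons ltnn eqxx andbF.
apply: big_pred0 => s; rewrite derange_scons_max fget_frcons ltnn eqxx /=.
by case: e; rewrite ?andbF.
Qed.

Lemma wt_opp n (s : sword n) : wt (- q) s = (-1) ^+ odd (negs s) * wt q s.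
Proof.
rewrite /wt (exprD (- q)) (exprD q) (exprM (- q)) sqrrN -exprM.
rewrite [(- q) ^+ negs s]exprNn -(signr_odd _ (negs s)).
set a := _ ^+ odd_perm _; set b := _ ^+ (2 * _); ring.
Qed.

(** Replacing [q] by [- q] multiplies each weight by the sign of [negs], so the half-difference
    keeps the odd part. *)
Lemma dersum_odd n : (2 : K) != 0 ->
  \sum_(s : sword n | derange s && odd (negs s)) wt q s
  = (dersum q n - dersum (- q) n) / 2.
Proof.
move=> nz2; apply: (canRL (mulfK nz2)).
rewrite /dersum -sumrB big_mkcondr mulr_suml; apply: eq_bigr => s _.
by rewrite wt_opp; case: (odd _) => /=; ring.
Qed.

End TypeD.

(** * Closed forms *)

Lemma one_minus_neq0 (K : fieldType) (x : K) : x ^+ 2 != 1 -> 1 - x != 0.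
Proof. by apply: contraNneq => /subr0_eq <-; rewrite expr1n. Qed.

Lemma one_plus_neq0 (K : fieldType) (x : K) : x ^+ 2 != 1 -> 1 + x != 0.
Proof. by rewrite -(sqrrN x) -{2}(opprK x); exact: one_minus_neq0. Qed.

Lemma one_minus_sqr (R : comNzRingType) (x : R) : 1 - x ^+ 2 = (1 - x) * (1 + x).
Proof. by ring. Qed.

Section ClosedForm.

Variables (K : fieldType) (q : K).
Hypothesis q2n1 : forall j, (0 < j)%N -> (q ^+ 2) ^+ j != 1.

Local Notation Q := (q ^+ 2).

Let sub1q_neq0 : 1 - q != 0 := one_minus_neq0 (q2n1 (ltn0Sn 0)).

Let add1q_neq0 : 1 + q != 0 := one_plus_neq0 (q2n1 (ltn0Sn 0)).

Let geom (z : K) n : (1 - z) * \sum_(i < n) z ^+ i = 1 - z ^+ n.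
Proof. by rewrite -opprB mulNr -subrX1 opprB. Qed.

Lemma sum_geom_even h :
  \sum_(i < h.*2.+1) ((-1) ^+ h.*2 * q) ^+ i = (1 - q ^+ h.*2.+1) / (1 - q).
Proof. by rewrite -signr_odd odd_double mul1r -geom mulrAC mulfV // mul1r. Qed.

Lemma sum_geom_odd h :
  \sum_(i < h.*2.+2) ((-1) ^+ h.*2.+1 * q) ^+ i = (1 - q ^+ h.*2.+2) / (1 + q).
Proof.
rewrite -signr_odd oddS odd_double mulN1r.
have -> : q ^+ h.*2.+2 = (- q) ^+ h.*2.+2.
  by rewrite exprNn -signr_odd !oddS odd_double /= expr0 mul1r.
by rewrite -geom opprK mulrAC mulfV // mul1r.
Qed.

Let sqr_fact n : (1 + q ^+ n) * (1 - q ^+ n) = 1 - Q ^+ n.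
Proof. by rewrite -exprM mulnC exprM; ring. Qed.

Lemma wsum_odd_step h :
  wsum q h.*2.+1 = wsum q h.*2 * (1 - Q ^+ h.*2.+1) / (1 - q).
Proof. by rewrite wsum_rec sum_geom_even -sqr_fact !mulrA. Qed.

Lemma wsum_even_step h :
  wsum q h.*2.+2 = wsum q h.*2.+1 * (1 - Q ^+ h.*2.+2) / (1 + q).
Proof. by rewrite wsum_rec sum_geom_odd -sqr_fact !mulrA. Qed.

(** Two consecutive steps have denominators of product [1 - Q]; this is the source of the exponent
    with a floor in the final formula. *)
Lemma wsum_even h : wsum q h.*2 = qpoch Q h.*2 / (1 - Q) ^+ h.
Proof.
elim: h => [|h IH]; first by rewrite wsum0 /qpoch big_geq // expr0 divr1.
rewrite doubleS wsum_even_step wsum_odd_step IH !qpochS [(1 - Q) ^+ h.+1]exprS one_minus_sqr exprMn.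
set x := _ ^+ h.*2.+1; set y := _ ^+ h.*2.+2; set z := qpoch _ _.
by field; rewrite ?expf_neq0 ?sub1q_neq0 ?add1q_neq0.
Qed.

Lemma wsum_odd h : wsum q h.*2.+1 = qpoch Q h.*2.+1 / ((1 - Q) ^+ h * (1 - q)).
Proof. by rewrite wsum_odd_step wsum_even qpochS invfM; ring. Qed.

Lemma qbin_symm n k : (k <= n)%N -> qbin Q n (n - k) = qbin Q n k.
Proof.
move=> le_kn; rewrite !(qbin_fracE q2n1) ?leq_subr // subKn //.
by rewrite [X in _ / X]mulrC.
Qed.

Lemma dersumE n : dersum q n =
  \sum_(k < n.+1) (-1) ^+ k * Q ^+ 'C(k, 2) * qbin Q n k * wsum q (n - k).
Proof.
rewrite (qbin_inversion q2n1 (z := 1) (a := wsum q) (b := dersum q)) => [|{}n].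
  by apply: eq_bigr => k _; rewrite expr1n mulr1.
rewrite wsum_dersum (reindex_inj rev_ord_inj) /=; apply: eq_bigr => k _.
by rewrite expr1n mul1r subSS qbin_symm // -ltnS.
Qed.

(** Inversion with [z = Q]: reversing the sum in [wsum_pos_dersum] turns [Q ^+ (n - m)] into
    [Q ^+ k]. *)
Lemma dersum_posE n : dersum_pos q n.+1 =
  \sum_(k < n.+1) (-1) ^+ k * Q ^+ 'C(k, 2) * Q ^+ k * qbin Q n k * wsum_pos q (n - k).
Proof.
apply: (qbin_inversion q2n1 (a := wsum_pos q) (b := fun m => dersum_pos q m.+1)) => {}n.
rewrite wsum_pos_dersum (reindex_inj rev_ord_inj) /=; apply: eq_bigr => k _.
have le_kn : (k <= n)%N by rewrite -ltnS.
by rewrite subSS subKn // qbin_symm // subSn.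
Qed.

Lemma prod_qint k : \prod_(1 <= j < k.+1) qint q (2 * j) = qpoch Q k / (1 - q) ^+ k.
Proof.
elim: k => [|k IH]; first by rewrite /qpoch !big_geq // expr0 divr1.
rewrite big_nat_recr //= IH qpochS /qint.
have -> : \sum_(i < 2 * k.+1) q ^+ i = (1 - Q ^+ k.+1) / (1 - q).
  by rewrite -exprM -geom mulrAC mulfV // mul1r.
by rewrite [(1 - q) ^+ k.+1]exprS invfM; ring.
Qed.

End ClosedForm.

(** * Assembling the formula *)

Section Main.

Variables (K : fieldType) (q : K).
Hypothesis q2n1 : forall j, (0 < j)%N -> (q ^+ 2) ^+ j != 1.
Hypothesis two_neq0 : (2 : K) != 0.

Local Notation Q := (q ^+ 2).

Definition main_term n k : K :=
  (-1) ^+ n * q ^+ (2 * 'C(k, 2)) / (\prod_(1 <= j < k.+1) qint q (2 * j))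
  * ((1 - q) / (1 + q)) ^+ ((n.+1 - k) %/ 2)
  * ((2 * q ^+ (2 * k + 1) * (1 + (-1) ^+ (n.+1 - k) * q ^+ (n.+1 - k - 1))
     - (1 + (-1) ^+ (n.+1 - k)) * q) / (2 * (1 - q))).

(** Allows the sum to run up to [k = n], the range of the inversion formulas. *)
Lemma main_term_last n : main_term n n = 0.
Proof. by rewrite /main_term subSnn subnn expr1 expr0 !mulr1 subrr mulr0 mul0r subrr mul0r mulr0. Qed.

Let sub1q_neq0 : 1 - q != 0 := one_minus_neq0 (q2n1 (ltn0Sn 0)).

Let add1q_neq0 : 1 + q != 0 := one_plus_neq0 (q2n1 (ltn0Sn 0)).

Let qN2n1 j : (0 < j)%N -> ((- q) ^+ 2) ^+ j != 1.
Proof. by rewrite sqrrN; exact: q2n1. Qed.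

(** For [n - k] even, [wsum] depends on [q ^+ 2] only and the difference vanishes. For [n - k] odd,
    the denominators [1 - q] and [1 + q] leave a factor [2 * q / (1 - q ^+ 2)], which gives the
    subtracted term of the formula. *)
Lemma main_termE n k : (k <= n)%N ->
  (\prod_(1 <= j < n.+1) qint q (2 * j)) * main_term n k =
  (-1) ^+ k * Q ^+ 'C(k, 2) * qbin Q n k *
    (Q ^+ k * wsum_pos q (n - k) + (wsum q (n - k) - wsum (- q) (n - k)) / 2).
Proof.
move=> le_kn; rewrite /main_term !(prod_qint q2n1) (qbin_fracE q2n1 le_kn) wsum_posE.
have -> : q ^+ (2 * k + 1) = Q ^+ k * q by rewrite exprD exprM.
rewrite exprM; set C := Q ^+ 'C(k, 2); set B := Q ^+ k.
have nzp m := qpoch_neq0 q2n1 m.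
have [h nk] : exists h, (n - k = h.*2 \/ n - k = h.*2.+1)%N.
  by exists (n - k)./2; have := odd_double_half (n - k); case: (odd _) => E; [right|left]; exact/esym.
case: nk => nk.
  have n_eq : n = (k + h.*2)%N by lia.
  have -> : (n.+1 - k = h.*2.+1)%N by lia.
  have -> : (h.*2.+1 %/ 2 = h)%N by lia.
  have -> : (h.*2.+1 - 1 = h.*2)%N by lia.
  rewrite nk (sum_geom_even q2n1) (wsum_even q2n1) (wsum_even qN2n1) sqrrN.
  have -> : (-1) ^+ n = (-1) ^+ k :> K.
    by rewrite n_eq exprD -[X in _ * X]signr_odd odd_double expr0 mulr1.
  have -> : (-1) ^+ h.*2.+1 = -1 :> K by rewrite -signr_odd oddS odd_double.
  have -> : (1 - q) ^+ n = (1 - q) ^+ k * (1 - q) ^+ h * (1 - q) ^+ h.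
    by rewrite n_eq exprD -addnn exprD mulrA.
  rewrite expr_div_n one_minus_sqr exprMn [q ^+ h.*2.+1]exprS.
  have nz1 m : (1 - q) ^+ m != 0 by rewrite expf_neq0.
  have nz2 m : (1 + q) ^+ m != 0 by rewrite expf_neq0.
  (* The powers become independent nonzero variables, so that the goal is a rational identity. *)
  move: (nzp n) (nzp k) (nzp h.*2) (nz1 h) (nz1 k) (nz2 h).
  move: (qpoch Q n) (qpoch Q k) (qpoch Q h.*2) ((1 - q) ^+ h) ((1 - q) ^+ k) ((1 + q) ^+ h).
  move: ((-1) ^+ k) (q ^+ h.*2) => s t a b c d e f *.
  by field; do ?[apply/andP; split].
have n_eq : n = (k + h.*2.+1)%N by lia.
have -> : (n.+1 - k = h.*2.+2)%N by lia.
have -> : (h.*2.+2 %/ 2 = h.+1)%N by lia.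
have -> : (h.*2.+2 - 1 = h.*2.+1)%N by lia.
rewrite nk (sum_geom_odd q2n1) (wsum_odd q2n1) (wsum_odd qN2n1) sqrrN opprK.
have -> : (-1) ^+ n = - (-1) ^+ k :> K.
  by rewrite n_eq exprD -[X in _ * X]signr_odd oddS odd_double expr1 mulrN1.
have -> : (-1) ^+ h.*2.+2 = 1 :> K by rewrite -signr_odd !oddS odd_double.
have -> : (1 - q) ^+ n = (1 - q) ^+ k * (1 - q) ^+ h * (1 - q) ^+ h * (1 - q).
  by rewrite n_eq exprD exprSr -addnn exprD !mulrA.
rewrite expr_div_n one_minus_sqr exprMn ![_ ^+ h.+1]exprS [q ^+ h.*2.+2]exprS.
have nz1 m : (1 - q) ^+ m != 0 by rewrite expf_neq0.
have nz2 m : (1 + q) ^+ m != 0 by rewrite expf_neq0.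
move: (nzp n) (nzp k) (nzp h.*2.+1) (nz1 h) (nz1 k) (nz2 h).
move: (qpoch Q n) (qpoch Q k) (qpoch Q h.*2.+1) ((1 - q) ^+ h) ((1 - q) ^+ k) ((1 + q) ^+ h).
move: ((-1) ^+ k) (q ^+ h.*2.+1) => s t a b c d e f *.
by field; do ?[apply/andP; split].
Qed.

Lemma sum_inDDE n :
  \sum_(s : sword n.+1 | inDD s) (-1) ^ (ellD s) * q ^+ Dmaj s
  = (\prod_(1 <= j < n.+1) qint q (2 * j)) * \sum_(0 <= k < n) main_term n k.
Proof.
rewrite sum_inDD dersum_odd // (dersum_posE q2n1) (dersumE q2n1) (dersumE qN2n1) sqrrN.
have -> : \sum_(0 <= k < n) main_term n k = \sum_(k < n.+1) main_term n k.
  by rewrite big_mkord big_ord_recr /= main_term_last addr0.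
rewrite -sumrB mulr_suml -big_split mulr_sumr; apply: eq_bigr => k _ /=.
by rewrite main_termE -1?ltnS //; ring.
Qed.

End Main.

Lemma qX_exp_neq1 j : (0 < j)%N -> (qX ^+ 2) ^+ j != 1.
Proof.
move=> j_gt0; rewrite -exprM /qX -rmorphXn /= -(rmorph1 (@FracField.tofrac _)) tofrac_eq.
apply/eqP => /(congr1 (fun p : {poly rat} => size p)).
by rewrite size_polyXn size_poly1; lia.
Qed.

Theorem theorem4p5 (n : nat) : (2 <= n)%N ->
  \sum_(s : sword n | inDD s) (-1) ^ (ellD s) * qX ^+ Dmaj s
  = (\prod_(1 <= j < n) qint qX (2 * j)) *
    \sum_(0 <= k < n.-1)
      ((-1) ^+ n.-1 * qX ^+ (2 * 'C(k, 2)) / (\prod_(1 <= j < k.+1) qint qX (2 * j))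
       * ((1 - qX) / (1 + qX)) ^+ ((n - k) %/ 2)
       * ((2 * qX ^+ (2 * k + 1) * (1 + (-1) ^+ (n - k) * qX ^+ (n - k - 1))
           - (1 + (-1) ^+ (n - k)) * qX)
          / (2 * (1 - qX)))).
Proof.
case: n => [|n] // _; apply: sum_inDDE; first exact: qX_exp_neq1.
rewrite -[2](rmorph_nat (@FracField.tofrac {poly rat})) tofrac_eq0.
by rewrite -(rmorph_nat (@polyC rat)) polyC_eq0.
Qed.
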